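(* Let $\mathscr{C}$ be a class of finite simple undirected graphs that has low rankwidth covers and a stable edge relation. Then $\mathscr{C}$ is linearly $\chi$-bounded: there is a constant $c$ such that $\chi(H)\le c\,\omega(H)$ for every induced subgraph $H$ of every graph in $\mathscr{C}$.
   Context: A class $\mathscr{C}$ has low rankwidth covers if for every positive integer $p$ there are a constant $C_p$ and a class $\mathscr{X}_p$ of bounded rankwidth such that every $G\in\mathscr{C}$ can be covered by $C_p$ induced subgraphs $H_1,\dots,H_{C_p}\in\mathscr{X}_p$ so that every set of $p$ vertices of $G$ is contained in $V(H_i)$ for some $i$. $\mathscr{C}$ has a stable edge relation if there is $t$ such that no graph in $\mathscr{C}$ contains the half-graph of order $t$ (vertices $a_1,\dots,a_t,b_1,\dots,b_t$, edges $a_ib_j$ for $i\le j$) as a semi-induced subgraph, i.e. isomorphic to $G[X,Y]$ for disjoint $X,Y\subseteq V(G)$, where $G[X,Y]$ has vertex set $X\cup Y$ and exactly the edges of $G$ between $X$ and $Y$. $\chi$ denotes chromatic number and $\omega$ clique number. *)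

(* Defs.v *)
From mathcomp Require Import all_boot all_algebra.

Set Implicit Arguments.
Unset Strict Implicit.
Unset Printing Implicit Defensive.

Record sgraph := SGraph {
  vertex :> finType;
  adj : rel vertex;
  adj_sym : symmetric adj;
  adj_irrefl : irreflexive adj
}.

Definition graph_class := sgraph -> Prop.

Definition isomorphic (G H : sgraph) : Prop :=
  exists f : G -> H, bijective f /\ forall x y, adj (f x) (f y) = adj x y.

Section InducedSubgraph.
Variables (G : sgraph) (A : {set G}).

Definition induced_adj : rel {x : G | x \in A} :=
  [rel x y | adj (val x) (val y)].

Fact induced_sym : symmetric induced_adj.
Proof. by move=> x y; rewrite /induced_adj /= adj_sym. Qed.

Fact induced_irrefl : irreflexive induced_adj.
Proof. by move=> x; rewrite /induced_adj /= adj_irrefl. Qed.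

Definition induced : sgraph := SGraph induced_sym induced_irrefl.
End InducedSubgraph.

(* The graph G[X, Y], used for disjoint X and Y. *)
Section SemiInducedSubgraph.
Variables (G : sgraph) (X Y : {set G}).

Definition semi_induced_adj : rel {x : G | x \in X :|: Y} :=
  [rel x y | adj (val x) (val y) &&
     ((val x \in X) && (val y \in Y) || (val x \in Y) && (val y \in X))].

Fact semi_induced_sym : symmetric semi_induced_adj.
Proof.
move=> x y; rewrite /semi_induced_adj /= adj_sym orbC.
by congr (_ && (_ || _)); rewrite andbC.
Qed.

Fact semi_induced_irrefl : irreflexive semi_induced_adj.
Proof. by move=> x; rewrite /semi_induced_adj /= adj_irrefl. Qed.

Definition semi_induced : sgraph := SGraph semi_induced_sym semi_induced_irrefl.
End SemiInducedSubgraph.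

Definition contains_semi_induced (G H : sgraph) : Prop :=
  exists X Y : {set G}, [disjoint X & Y] /\ isomorphic H (semi_induced X Y).

(* inl i is a_i and inr j is b_j. *)
Section HalfGraph.
Variable t : nat.

Definition half_graph_adj : rel ('I_t + 'I_t)%type := fun u v =>
  match u, v with
  | inl i, inr j => i <= j
  | inr j, inl i => i <= j
  | _, _ => false
  end.

Fact half_graph_sym : symmetric half_graph_adj.
Proof. by move=> [i|i] [j|j]. Qed.

Fact half_graph_irrefl : irreflexive half_graph_adj.
Proof. by move=> [i|i]. Qed.

Definition half_graph : sgraph := SGraph half_graph_sym half_graph_irrefl.
End HalfGraph.

Definition stable_edge_relation (C : graph_class) : Prop :=
  exists t : nat, forall G, C G -> ~ contains_semi_induced G (half_graph t).

Definition degree (G : sgraph) (x : G) : nat := #|[set y | adj x y]|.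

Definition is_tree (T : sgraph) : Prop :=
  [/\ 0 < #|T|,
      forall x y : T, connect (@adj T) x y
    & forall c : seq T, 2 < size c -> ~ ucycle (@adj T) c].

Definition leaf (T : sgraph) (x : T) : bool := degree x == 1.

(* A subcubic tree T whose leaves are in bijection, via L, with V(G). *)
Definition rank_decomposition (G T : sgraph) (L : G -> T) : Prop :=
  [/\ is_tree T,
      forall x : T, degree x <= 3,
      injective L
    & [set L x | x : G] = [set y | leaf y]].

Definition cut_rank (G : sgraph) (A : {set G}) : nat :=
  \rank (\matrix_(i < #|A|, j < #|~: A|)
           (adj (enum_val i) (enum_val j))%:R : 'M['F_2]_(#|A|, #|~: A|))%R.

(* The vertices of G mapped to the component of u in T - uv. *)
Definition edge_side (G T : sgraph) (L : G -> T) (u v : T) : {set G} :=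
  [set x | connect [rel a b | adj a b && ([set a; b] != [set u; v])] u (L x)].

(* A graph with at most one vertex has no rank decomposition (a tree never has
   exactly one leaf); its rankwidth is 0 by convention. *)
Definition rankwidth_le (G : sgraph) (r : nat) : Prop :=
  #|G| <= 1 \/
  exists (T : sgraph) (L : G -> T), rank_decomposition L /\
    forall u v : T, adj u v -> cut_rank (edge_side L u v) <= r.

Definition bounded_rankwidth (X : graph_class) : Prop :=
  exists r : nat, forall G, X G -> rankwidth_le G r.

Definition low_rankwidth_covers (C : graph_class) : Prop :=
  forall p : nat, 0 < p ->
  exists (N : nat) (X : graph_class), bounded_rankwidth X /\
    forall G, C G ->
    exists U : 'I_N -> {set G},
      [/\ forall i, X (induced (U i)),
          \bigcup_i U i = [set: G]
        & forall S : {set G}, #|S| = p -> exists i, S \subset U i].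

Definition colorable (G : sgraph) (k : nat) : bool :=
  [exists f : {ffun G -> 'I_k}, forall x, forall y, adj x y ==> (f x != f y)].

Fact colorable_ex (G : sgraph) : exists k, colorable G k.
Proof.
exists #|G|; apply/existsP; exists [ffun x => enum_rank x].
apply/forallP=> x; apply/forallP=> y; apply/implyP=> xy; rewrite !ffunE.
by apply: contraTneq xy => /enum_rank_inj ->; rewrite adj_irrefl.
Qed.

Definition chromatic_number (G : sgraph) : nat := ex_minn (colorable_ex G).

Definition clique (G : sgraph) (K : {set G}) : bool :=
  [forall x in K, forall y in K, (x != y) ==> adj x y].

Definition clique_number (G : sgraph) : nat :=
  \max_(K : {set G} | clique K) #|K|.

Definition linearly_chi_bounded (C : graph_class) : Prop :=
  exists c : nat, forall G, C G -> forall A : {set G},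
    chromatic_number (induced A) <= c * clique_number (induced A).

(* Main.v *)
(* Taking [p = 1] in the definition of covers, it suffices to partition every graph of
   rankwidth at most [r] without half-graph of order [t] into a bounded number of
   induced cographs, since chi = omega for cographs.

   The rank decomposition gives a laminar family in which each set [X] has at most
   [2 ^ r] types (neighbourhoods outside [X]).  Say that [Q] is [j]-scattered in [X] if
   it meets in at most one vertex every subset [W] of [X] in the family whose vertices
   have fewer than [j] types over [X].  By downward induction on [j], [j]-scattered sets
   are partitionable.  Fix the type of [Q] over [X] and cut [X] repeatedly into the
   maximal members of the family with at most [j] types over the current block.  This
   gives a tree of blocks in which every block is homogeneous, in [Q], to the complement
   of its parent, and in which transversals of the children of a block are
   [j+1]-scattered, or have at most two vertices when the block itself has at most [j]
   types.

   Such a tree is handled by induction on the length [d] of the chains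
   X_0 > X_1 > ... > X_d in which each X_i contains a vertex complete and a vertex
   anticomplete to X_(i+1); long chains produce half-graphs.  If the length is at most
   [d] in the whole set, then a block where length [d] is still attained is complete or
   anticomplete to the complement of its parent, and blocks where it is not are handled
   by induction. *)

Require Import Defs.
From Stdlib Require Import Classical_Prop.
From mathcomp Require Import all_boot all_algebra zify.

Set Implicit Arguments.
Unset Strict Implicit.
Unset Printing Implicit Defensive.

(** * Cographs *)

Section Cographs.
Variable G : sgraph.
Implicit Types S X Y : {set G}.

(** The gluing is a disjoint union for [e = false] and a join for [e = true]; in a join [X] and [Y]
    cannot meet, since adjacency is irreflexive. *)
Inductive cograph : {set G} -> Prop :=
| cograph_small S of #|S| <= 1 : cograph S
| cograph_glue S X Y e of S = X :|: Y & cograph X & cograph Y &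
    {in X & Y, forall x y, adj x y = e} : cograph S.

Lemma cograph_sub S X : cograph S -> X \subset S -> cograph X.
Proof.
move=> cS; elim: cS X => {S} [S le1|S A B e -> _ IHA _ IHB AB] X sXS.
  by apply: cograph_small; apply: leq_trans (subset_leq_card sXS) le1.
apply: (@cograph_glue _ (X :&: A) (X :&: B) e).
- by rewrite -setIUr; apply/esym/setIidPl.
- exact/IHA/subsetIr.
- exact/IHB/subsetIr.
- by move=> x y /setIP[_ xA] /setIP[_ yB]; apply: AB.
Qed.

(** Closure under substitution: [S] replaces each vertex [z] of the cograph [phi @: S] by the fibre
    over [z], so the decomposition of the image lifts. *)
Lemma cograph_subst S (phi : G -> G) :
  cograph (phi @: S) ->
  {in S &, forall x y, phi x != phi y -> adj x y = adj (phi x) (phi y)} ->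
  (forall z, cograph [set x in S | phi x == z]) -> cograph S.
Proof.
move=> cphi; have [I defI] : exists I, I = phi @: S by exists (phi @: S).
rewrite -defI in cphi; elim: cphi S defI => {I} [I le1|I A B e defAB cA IHA cB IHB AB] S defI modS fibS.
  have [->|/set0Pn[x xS]] := eqVneq S set0; first by apply: cograph_small; rewrite cards0.
  apply: cograph_sub (fibS (phi x)) _; apply/subsetP=> y yS.
  rewrite inE yS /=; apply/eqP/(card_le1_eqP le1); by rewrite defI imset_f.
pose part (D : {set G}) := [set x in S | phi x \in D].
have partP (D : {set G}) : D \subset I -> D = phi @: part D.
  move=> /subsetP sD; apply/setP=> z; apply/idP/imsetP => [zD|[x]].
    have := sD _ zD; rewrite defI => /imsetP[x xS defz].
    by exists x; rewrite // inE xS -defz.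
  by rewrite inE => /andP[_ xD] ->.
have cpart (D : {set G}) : D \subset I ->
    (forall S, D = phi @: S ->
       {in S &, forall x y, phi x != phi y -> adj x y = adj (phi x) (phi y)} ->
       (forall z, cograph [set x in S | phi x == z]) -> cograph S) -> cograph (part D).
  move=> sD; apply; first exact: partP.
    by move=> x y; rewrite !inE => /andP[xS _] /andP[yS _]; apply: modS.
  move=> z; apply: cograph_sub (fibS z) _; apply/subsetP=> x.
  by rewrite !inE -andbA => /and3P[-> _ ->].
have sA : A \subset I by rewrite defAB subsetUl.
(* Adjacency within a fibre is not constant, so a fibre over [A :&: B] must go to one side only. *)
have sB : B :\: A \subset I by rewrite defAB subDset setUA setUid subsetUr.
have sBB : B \subset I by rewrite defAB subsetUr.
have cpB : cograph (part (B :\: A)).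
  apply: cograph_sub (cpart B sBB IHB) _; apply/subsetP=> x.
  by rewrite !inE => /and3P[-> _ ->].
apply: (cograph_glue _ (cpart A sA IHA) cpB).
- apply/setP=> x; rewrite !inE -andb_orr; apply/esym; case xS: (x \in S) => //=.
  have : phi x \in I by rewrite defI imset_f.
  by rewrite defAB inE; case: (phi x \in A).
- move=> x y; rewrite !inE => /andP[xS xA] /and3P[yS nyA yB].
  rewrite modS //; first exact: AB.
  by apply: contraNneq nyA => <-.
Qed.

Lemma cograph_uniform_blocks (D : eqType) (key : G -> D) S e :
  {in S &, forall x y, key x != key y -> adj x y = e} ->
  (forall d, cograph [set x in S | key x == d]) -> cograph S.
Proof.
have [n] := ubnP #|S|; elim: n S => // n IHn S ltSn unif fib.
have [->|[x xS]] := set_0Vmem S; first by apply: cograph_small; rewrite cards0.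
pose X := [set y in S | key y == key x]; have xX : x \in X by rewrite inE xS eqxx.
have sXS : X \subset S by apply/subsetP=> y; rewrite inE => /andP[].
apply: (@cograph_glue S X (S :\: X) e) => //.
- by rewrite setDE setUIr setUCr setIT; apply/esym/setUidPr.
- exact: fib.
- apply: IHn; first by rewrite -ltnS; apply: leq_trans ltSn; rewrite ltnS; apply: proper_card;
      apply/properP; split; [exact: subsetDl|exists x; rewrite // inE xX].
    by move=> y z /setDP[yS _] /setDP[zS _]; apply: unif.
  move=> d; apply: cograph_sub (fib d) _; apply/subsetP=> y.
  by rewrite !inE -andbA => /and3P[_ -> ->].
- move=> y z; rewrite !inE => /andP[yS /eqP ey] /andP[nz zS].
  by apply: unif; rewrite // ey; rewrite zS /= eq_sym in nz.
Qed.

Lemma cograph_card2 S : #|S| <= 2 -> cograph S.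
Proof.
move=> le2; have [->|[x xS]] := set_0Vmem S; first by apply: cograph_small; rewrite cards0.
have le1 : #|S :\ x| <= 1 by rewrite (cardsD1 x) xS in le2.
have [S0|[y yS]] := set_0Vmem (S :\ x).
  by apply: cograph_small; rewrite (cardsD1 x) xS S0 cards0.
apply: (@cograph_glue S [set x] (S :\ x) (adj x y)); rewrite ?setD1K //.
- by apply: cograph_small; rewrite cards1.
- exact: cograph_small.
- by move=> u z /set1P-> /(card_le1_eqP le1 _ _ yS) ->.
Qed.

(** This is chi = omega: in a join cliques and palettes add up, in a disjoint union the larger
    clique bounds both palettes. *)
Lemma cograph_coloring S : cograph S ->
  exists (K : {set G}) (f : G -> nat), [/\ K \subset S, clique K, {in S, forall x, f x < #|K|}
                & {in S &, forall x y, adj x y -> f x != f y :> nat}].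
Proof.
elim=> {S} [S le1|S X Y e -> _ [K [f [sK cK fK fX]]] _ [L [g [sL cL gL gY]]] XY].
  exists S, (fun=> 0); split=> // [|x xS|x y xS yS].
  - apply/forall_inP=> x xS; apply/forall_inP=> y yS; apply/implyP.
    by rewrite (card_le1_eqP le1 _ _ xS yS) eqxx.
  - by rewrite (cardD1 x) xS.
  - by rewrite (card_le1_eqP le1 _ _ xS yS) adj_irrefl.
have YX : {in Y & X, forall x y, adj x y = e}.
  by move=> x y xY yX; rewrite adj_sym XY.
case: e XY YX => XY YX.
  have disXY : [disjoint K & L].
    apply/pred0P=> x /=; apply/negP=> /andP[/(subsetP sK) xX /(subsetP sL) xY].
    by have := XY x x xX xY; rewrite adj_irrefl.
  have cKL : #|K :|: L| = #|K| + #|L|.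
    by rewrite cardsU (disjoint_setI0 disXY) cards0 subn0.
  exists (K :|: L), (fun x => if x \in X then f x else #|K| + g x); split.
  - exact: setUSS.
  - apply/forall_inP=> x xKL; apply/forall_inP=> y yKL; apply/implyP=> xy.
    move: xKL yKL; rewrite !inE.
    case/orP=> [xK|xL] /orP[yK|yL].
    + by have/forall_inP/(_ x xK)/forall_inP/(_ y yK)/implyP := cK; apply.
    + by apply: XY; [apply: (subsetP sK)|apply: (subsetP sL)].
    + by apply: YX; [apply: (subsetP sL)|apply: (subsetP sK)].
    + by have/forall_inP/(_ x xL)/forall_inP/(_ y yL)/implyP := cL; apply.
  - move=> x; rewrite inE cKL; case: ifP => [xX _|_ /= xY].
      by apply: leq_trans (fK _ xX) (leq_addr _ _).
    by rewrite ltn_add2l gL.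
  - move=> x y; rewrite !inE; case: ifP => xX /=; case: ifP => yX //= xS yS xy.
    + exact: fX.
    + by rewrite neq_ltn (leq_trans (fK _ xX)) ?leq_addr.
    + by rewrite neq_ltn (leq_trans (fK _ yX)) ?leq_addr ?orbT.
    + by rewrite eqn_add2l gY.
exists (if #|L| <= #|K| then K else L), (fun x => if x \in X then f x else g x); split.
- by case: ifP => _; [apply: subsetU; rewrite sK|apply: subsetU; rewrite sL orbT].
- by case: ifP.
- move=> x; rewrite inE; case: ifP => [xX _|_ /= xY]; case: (leqP #|L| #|K|) => LK.
  + exact: fK.
  + exact: ltn_trans (fK _ xX) LK.
  + exact: leq_trans (gL _ xY) LK.
  + exact: gL.
- move=> x y; rewrite !inE; case: ifP => xX /=; case: ifP => yX //= xS yS xy.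
  + exact: fX.
  + by rewrite XY in xy.
  + by rewrite YX in xy.
  + exact: gY.
Qed.

(** Taking colours in a finite type lets successive refinements use product types. *)
Definition cograph_colorable (T : finType) S : Prop :=
  exists f : G -> T, forall c, cograph [set x in S | f x == c].

Lemma cograph_colorable1 (T : finType) S (c : T) : cograph S -> cograph_colorable T S.
Proof.
move=> cS; exists (fun=> c) => c'; apply: cograph_sub cS _.
by apply/subsetP=> x; rewrite inE => /andP[].
Qed.

Lemma cograph_colorable_split (D T : finType) (g : G -> D) S :
  (forall c, cograph_colorable T [set x in S | g x == c]) ->
  cograph_colorable (D * T)%type S.
Proof.
move/fin_all_exists=> [f cf]; exists (fun x => (g x, f (g x) x)) => -[d c].
apply: cograph_sub (cf d c) _; apply/subsetP=> x; rewrite !inE xpair_eqE.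
by case/and3P=> -> /eqP-> ->; rewrite eqxx.
Qed.

(** Fixing one colouring per set makes the colours of two vertices comparable as soon as their
    blocks coincide. *)
Lemma cograph_colorable_choice (T : finType) (t0 : T) : exists F : {set G} -> G -> T,
  forall S, cograph_colorable T S -> forall c, cograph [set x in S | F S x == c].
Proof.
suff : forall S, exists f : G -> T,
    cograph_colorable T S -> forall c, cograph [set x in S | f x == c].
  by move/fin_all_exists.
move=> S; have [[f fP]|nP] := classic (cograph_colorable T S).
  by exists f.
by exists (fun=> t0) => /nP.
Qed.

End Cographs.

(** * Alternating chains and half-graphs *)

Section Stability.
Variable G : sgraph.
Implicit Types X Y : {set G}.

(** Chains of length [n] starting at [X]. Irreflexivity already keeps [a] out of [Y], but not [b].
    The base case asks for two vertices, so its failure leaves a trivial set. *)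
Fixpoint alternates n X : bool :=
  if n is n'.+1 then
    [exists Y : {set G}, [exists a in X, [exists b in X :\: Y,
      [&& Y \subset X, alternates n' Y & [forall y in Y, adj a y && ~~ adj b y]]]]]
  else 1 < #|X|.

Lemma alternatesS n X Y a b :
  Y \subset X -> a \in X -> b \in X :\: Y -> alternates n Y ->
  {in Y, forall y, adj a y /\ ~~ adj b y} -> alternates n.+1 X.
Proof.
move=> /= sYX aX bX altY abY; apply/existsP; exists Y; apply/exists_inP; exists a => //.
apply/exists_inP; exists b => //; rewrite sYX altY; apply/forall_inP=> y yY.
exact/andP/abY.
Qed.

Lemma alternates_sub n X Y : alternates n Y -> Y \subset X -> alternates n X.
Proof.
case: n => [|n] /= altY sYX; first exact: leq_trans altY (subset_leq_card sYX).
case/existsP: altY => Z /exists_inP[a aY /exists_inP[b /setDP[bY bZ] /and3P[sZY altZ abZ]]].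
apply/existsP; exists Z; apply/exists_inP; exists a; first exact: (subsetP sYX).
apply/exists_inP; exists b; first by rewrite inE bZ (subsetP sYX).
by rewrite altZ abZ (subset_trans sZY).
Qed.

Lemma alternates_seq n X : alternates n X -> exists a b : nat -> G,
  [/\ forall i, i < n -> a i \in X /\ b i \in X,
      forall i j, i < j < n -> [/\ adj (a i) (a j), adj (a i) (b j) & ~~ adj (b i) (a j)]
    & forall i j, i < j < n -> (b i != a j) && (b i != b j)].
Proof.
elim: n X => [|n IHn] X /=.
  case/card_gt1P=> x _; exists (fun=> x), (fun=> x).
  by split=> [i|i j|i j]; rewrite ?ltn0 ?andbF.
case/existsP=> Y /exists_inP[a aX /exists_inP[b /setDP[bX bY] /and3P[sYX altY /forall_inP abY]]].
have [a' [b' [Yab adjab neqab]]] := IHn Y altY.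
exists (fun i => if i is i'.+1 then a' i' else a), (fun i => if i is i'.+1 then b' i' else b).
split=> [[|i] //= lt_i|[|i] [|j] //= lt_j|[|i] [|j] //= lt_j].
- by have [aY bYi] := Yab i lt_i; split; apply: (subsetP sYX).
- have [aY bYj] := Yab j lt_j.
  by have /andP[-> _] := abY _ bYj; have /andP[-> ->] := abY _ aY.
- exact: adjab.
- have [aY bYj] := Yab j lt_j.
  by apply/andP; split; apply: contraNneq bY => ->.
- exact: neqab.
Qed.

Definition half_graph_free t := forall a b : 'I_t -> G,
  injective a -> injective b -> (forall i j, a i != b j) ->
  ~ forall i j : 'I_t, adj (a i) (b j) = (i <= j).

(** Even [a] and odd [b] form the half-graph: for [i <= j], [b j.*2.+1] lies in the set complete to
    [a i.*2]; for [j < i], [a i.*2] lies in the set anticomplete to [b j.*2.+1]. *)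
Lemma half_graph_free_alternates t X : half_graph_free t -> ~~ alternates t.*2 X.
Proof.
move=> freeG; apply/negP=> /alternates_seq[a [b [_ adjab neqab]]].
have ltt (i : 'I_t) : i.*2 < t.*2 by rewrite ltn_double.
have ltSt (i : 'I_t) : i.*2.+1 < t.*2 by rewrite ltn_Sdouble.
have a_inj (i j : 'I_t) : i < j -> a i.*2 != a j.*2.
  move=> ltij; have [|adj_ij _ _] := adjab i.*2 j.*2; first by rewrite ltn_double ltij ltt.
  by apply: contraTneq adj_ij => ->; rewrite adj_irrefl.
have b_inj (i j : 'I_t) : i < j -> b i.*2.+1 != b j.*2.+1.
  move=> ltij; have := neqab i.*2.+1 j.*2.+1.
  by rewrite ltnS ltn_double ltij ltSt => /(_ isT)/andP[].
have adjE (i j : 'I_t) : adj (a i.*2) (b j.*2.+1) = (i <= j).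
  case: leqP => [leij|ltji].
    have [|_ -> _ //] := adjab i.*2 j.*2.+1.
    by rewrite ltnS leq_double leij ltSt.
  have [|_ _ /negPf] := adjab j.*2.+1 i.*2; first by rewrite ltn_Sdouble ltji ltt.
  by rewrite adj_sym.
apply: (freeG (fun i => a i.*2) (fun j => b j.*2.+1)) => //.
- move=> i j eq_a; apply: val_inj; have [/a_inj|/a_inj|//] := ltngtP i j.
    by rewrite eq_a eqxx.
  by rewrite eq_a eqxx.
- move=> i j eq_b; apply: val_inj; have [/b_inj|/b_inj|//] := ltngtP i j.
    by rewrite eq_b eqxx.
  by rewrite eq_b eqxx.
- move=> i j; have [leij|ltji] := leqP i j.
    by apply: contraTneq leij => eq_ab; rewrite -adjE eq_ab adj_irrefl.
  rewrite eq_sym; have := neqab j.*2.+1 i.*2.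
  by rewrite ltn_Sdouble ltji ltt => /(_ isT)/andP[].
Qed.

Lemma half_graph_freeP t : ~ contains_semi_induced G (half_graph t) -> half_graph_free t.
Proof.
move=> noG a b a_inj b_inj ab_neq adjE; apply: noG.
pose X := [set a i | i : 'I_t]; pose Y := [set b i | i : 'I_t].
have aX i : a i \in X by apply: imset_f.
have bY i : b i \in Y by apply: imset_f.
have disXY : [disjoint X & Y].
  apply/pred0P=> x /=; apply/negP=> /andP[/imsetP[i _ ->] /imsetP[j _ eqab]].
  by have := ab_neq i j; rewrite eqab eqxx.
have aY i : (a i \in Y) = false by apply: (disjointFr disXY).
have bX i : (b i \in X) = false by apply: (disjointFl disXY).
exists X, Y; split=> //.
pose g (s : half_graph t) : G := match s with inl i => a i | inr j => b j end.
have gXY s : g s \in X :|: Y by case: s => i /=; rewrite inE ?aX ?bY ?orbT.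
have g_inj : injective g.
  case=> i [] j /= => [/a_inj->|eqab|eqba|/b_inj->] //.
    by have := ab_neq i j; rewrite eqab eqxx.
  by have := ab_neq j i; rewrite eqba eqxx.
exists (fun s => exist _ (g s) (gXY s) : semi_induced X Y); split.
  apply: inj_card_bij => [s s' /(congr1 val)/g_inj //|].
  rewrite card_sig -(card_imset _ g_inj); apply/subset_leq_card/subsetP=> x.
  rewrite !inE => /orP[] /imsetP[i _ ->].
    exact: (imset_f g (x := inl i : half_graph t)).
  exact: (imset_f g (x := inr i : half_graph t)).
case=> i [] j; rewrite /= /semi_induced_adj /= ?aX ?bY ?aY ?bX ?andbF ?andbT //=.
by rewrite adj_sym.
Qed.

End Stability.

Lemma half_graph_free_induced (G : sgraph) (A : {set G}) t :
  half_graph_free G t -> half_graph_free (induced A) t.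
Proof.
move=> freeG a b a_inj b_inj ab adjE; apply: (freeG (val \o a) (val \o b)) => //.
- exact: inj_comp val_inj a_inj.
- exact: inj_comp val_inj b_inj.
Qed.

(** * Trees of homogeneous blocks *)

(** One layer per chain length: a parity, an adjacency bit, types at two depths, cograph colours at
    two depths, and a colour for shorter chains. *)
Fixpoint level_colors (T : finType) k d : finType :=
  if d is d'.+1 then (bool * bool * 'I_k * 'I_k * T * T * level_colors T k d')%type
  else unit.

Fixpoint level_color0 (T : finType) (t0 : T) k d : level_colors T k.+1 d :=
  if d is d'.+1 then (true, true, ord0, ord0, t0, t0, level_color0 t0 k d') else tt.

Section Levels.
Variables (G : sgraph) (k : nat) (T : finType) (t0 : T).
Variables (B : nat -> G -> {set G}) (p : nat -> G -> 'I_k.+1).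

(* [B i u] is the block of [u] at depth [i] of a tree of nested partitions, and
   [p i u] the type of [u] in this block: it determines the neighbours of [u]
   outside the block. *)
Record leveled (Q : {set G}) : Prop := Leveled {
  block_self : forall i, {in Q, forall u, u \in B i u};
  block_eq : forall i, {in Q &, forall u v, v \in B i u -> B i v = B i u};
  block_sub : forall i, {in Q, forall u, B i.+1 u \subset B i u};
  block_top : {in Q, forall u, Q \subset B 0 u};
  block_bottom : {in Q, forall u, exists i, B i.+2 u = [set u]};
  block_hom : forall i, {in Q & Q & Q, forall u v r,
    v \in B i.+1 u -> r \notin B i u -> adj r u = adj r v};
  block_type : forall i, {in Q & Q & Q, forall u v r,
    v \in B i u -> p i v = p i u -> r \notin B i u -> adj r u = adj r v};
  block_transversal : forall i (X : {set G}), X \subset Q ->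
    {in X &, forall u v, v \in B i u /\ (v \in B i.+1 u -> v = u)} ->
    cograph_colorable T X }.

Lemma leveled_sub (Q X : {set G}) : leveled Q -> X \subset Q -> leveled X.
Proof.
case=> self eqB sub top bot hom typ tra sXQ.
have sX : {subset X <= Q} := subsetP sXQ.
split.
- by move=> i u /sX; apply: self.
- by move=> i u v /sX uQ /sX vQ; apply: eqB.
- by move=> i u /sX; apply: sub.
- by move=> u /sX uQ; apply: subset_trans sXQ (top u uQ).
- by move=> u /sX; apply: bot.
- by move=> i u v r /sX uQ /sX vQ /sX rQ; apply: hom.
- by move=> i u v r /sX uQ /sX vQ /sX rQ; apply: typ.
- by move=> i Y sYX; apply: tra; apply: subset_trans sYX sXQ.
Qed.

(** For each vertex a critical depth is found: outside its block there the vertex is homogeneous,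
    and two levels further down chains are shorter and induction applies. Substitution bridges the
    two levels. *)
Lemma leveled_colorable d (Q : {set G}) : leveled Q -> ~~ alternates d Q ->
  cograph_colorable (level_colors T k.+1 d) Q.
Proof.
elim: d Q => [|d IHd] Q levQ nalt.
  by apply: (cograph_colorable1 (tt : level_colors T k.+1 0)); apply: cograph_small; rewrite leqNgt.
case: (levQ) => self eqB sub top bot hom typ tra.
have symB i : {in Q &, forall u v, v \in B i u -> u \in B i v}.
  by move=> u v uQ vQ vu; rewrite (eqB i u v) ?self.
(* The shift by two is chosen so that, when [h u > 0], the block at depth [(h u).+1] still has a
   chain of length [d] and is homogeneous to the complement of [B (h u) u]. *)
have [h hP] : exists h : G -> nat, forall u, u \in Q ->
    ~~ alternates d (Q :&: B (h u).+2 u) /\ forall i, i < h u -> alternates d (Q :&: B i.+2 u).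
  apply: (fin_all_exists (P := fun u n => u \in Q ->
    ~~ alternates d (Q :&: B n.+2 u) /\ forall i, i < n -> alternates d (Q :&: B i.+2 u))).
  move=> u; have [uQ|] := boolP (u \in Q); last by exists 0.
  have ex_h : exists n, ~~ alternates d (Q :&: B n.+2 u).
    have [n Bn] := bot u uQ; exists n; rewrite Bn; case: (d) => [|d'].
      rewrite /= -leqNgt; apply: leq_trans (subset_leq_card (subsetIr _ _)) _.
      by rewrite cards1.
    apply/negP=> /existsP[Y /exists_inP[a _ /exists_inP[b /setDP[bX bY] /and3P[sY altY adjab]]]].
    have /set0Pn[y yY] : Y != set0.
      apply: contraTneq altY => ->; case: d' => [|d'] /=; first by rewrite cards0.
      apply/negP=> /existsP[Z /exists_inP[c]]; by rewrite inE.
    move: bX (subsetP sY y yY); rewrite !inE => /andP[_ /eqP eqb] /andP[_ /eqP eqy].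
    by rewrite eqb -eqy yY in bY.
  exists (ex_minn ex_h) => _; case: ex_minnP => n altn minn; split=> // i lt_in.
  by apply: contraTT lt_in => /minn; rewrite leqNgt.
pose S i u := [set x in Q | (x \in B i u) && (p i x == p i u)].
(* The representative depends only on the block and type of [u] at depth [i], and has the same
   neighbours as [u] in [Q] outside that block. *)
pose rep i u := odflt u [pick x in S i u].
have repP i u : u \in Q -> [/\ rep i u \in Q, rep i u \in B i u & p i (rep i u) = p i u].
  move=> uQ; rewrite /rep; case: pickP => [x|/(_ u)] /=.
    by rewrite inE => /and3P[xQ xB /eqP].
  by rewrite inE uQ self ?eqxx.
have rep_eq i : {in Q &, forall u v, v \in B i u -> p i v = p i u -> rep i v = rep i u}.
  move=> u v uQ vQ vu pvu.
  have eqS : S i v = S i u by apply/setP=> x; rewrite !inE (eqB _ u v) // pvu.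
  rewrite /rep eqS; case: pickP => // /(_ u); by rewrite inE uQ self ?eqxx.
have rep_block i : {in Q, forall u, B i (rep i u) = B i u}.
  by move=> u uQ; have [rQ rB _] := repP i u uQ; apply: eqB.
(* With the type fixed, each child block has one representative, so [R i u] is a transversal of the
   children of [B i u]. *)
pose R i u := rep i.+1 @: [set x in Q | (x \in B i u) && (p i.+1 x == p i.+1 u)].
have RP i u : u \in Q -> cograph_colorable T (R i u).
  move=> uQ; apply: (tra i).
    apply/subsetP=> _ /imsetP[x xX ->].
    by move: xX; rewrite inE => /andP[xQ _]; have [] := repP i.+1 x xQ.
  move=> _ _ /imsetP[x xX ->] /imsetP[y yX ->].
  move: xX yX; rewrite !inE => /and3P[xQ xB /eqP px] /and3P[yQ yB /eqP py].
  have [rxQ rxB _] := repP i.+1 x xQ; have [ryQ ryB _] := repP i.+1 y yQ.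
  have sB z : z \in Q -> rep i.+1 z \in B i z.
    by move=> zQ; have [_ /(subsetP (sub i z zQ))] := repP i.+1 z zQ.
  have eqBr z : z \in Q -> z \in B i u -> B i (rep i.+1 z) = B i u.
    move=> zQ zu; have [rzQ _ _] := repP i.+1 z zQ.
    by rewrite (eqB _ z) ?sB // (eqB _ u).
  split; first by rewrite eqBr // -(eqBr y) // self.
  rewrite rep_block // => ryx; apply: rep_eq => //; last by rewrite py px.
  by rewrite -(eqB i.+1 _ _ xQ ryQ ryx) rep_block ?self.
have [F FP] := cograph_colorable_choice G t0.
have [F' F'P] := cograph_colorable_choice G (level_color0 t0 k d).
(* Vertices of [X] in different children are adjacent exactly when their representatives are, so [X]
   is a substitution into a colour class of the transversal. *)
have refine i a (X : {set G}) : X \subset Q ->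
    {in X &, forall u v, v \in B i u /\ p i.+1 v = p i.+1 u} ->
    {in X, forall u, F (R i u) (rep i.+1 u) = a} ->
    (forall z, cograph [set x in X | rep i.+1 x == z]) -> cograph X.
  move=> /subsetP sXQ eqX colX; apply: cograph_subst.
    have [->|[u uX]] := set_0Vmem X; first by apply: cograph_small; rewrite imset0 cards0.
    apply: cograph_sub (FP _ (RP i u (sXQ u uX)) a) _.
    apply/subsetP=> _ /imsetP[v vX ->].
    have [vBu pvu] := eqX u v uX vX.
    have eqR : R i u = R i v.
      rewrite /R; suff -> : [set x in Q | (x \in B i v) && (p i.+1 x == p i.+1 v)] =
        [set x in Q | (x \in B i u) && (p i.+1 x == p i.+1 u)] by [].
      by rewrite pvu (eqB i u v) ?sXQ.
    rewrite inE -(colX v vX) -eqR eqxx andbT eqR; apply: imset_f.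
    by rewrite inE sXQ // self ?sXQ //=.
  move=> u v uX vX nrep; have [uQ vQ] := (sXQ u uX, sXQ v vX).
  have [_ puv] := eqX v u vX uX.
  have nuv : u \notin B i.+1 v by apply: contraNN nrep => uv; rewrite (rep_eq _ v u).
  have nvu : v \notin B i.+1 u by apply: contraNN nuv; apply: symB.
  have [ruQ ruB pru] := repP i.+1 u uQ; have [rvQ rvB prv] := repP i.+1 v vQ.
  rewrite adj_sym (typ i.+1 u (rep i.+1 u)) // adj_sym (typ i.+1 v (rep i.+1 v)) //.
  apply: contraNN nuv => ruv; rewrite -(eqB i.+1 v _ vQ ruQ ruv) rep_block //.
  exact: self.
pose eps u := [exists r in Q :\: B (h u) u, adj r u].
(* A neighbour and a non-neighbour of [u] outside [B (h u) u] would be complete and anticomplete to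
   the block one level below, extending its chain of length [d] to [d.+1]. *)
have epsP u r : u \in Q -> r \in Q -> r \notin B (h u) u -> adj r u = eps u.
  move=> uQ rQ nru; apply/idP/existsP=> [ru|[r' /andP[/setDP[rQ' nru'] ru']]].
    by exists r; rewrite inE nru rQ.
  apply: contraNT nalt => nadj.
  have [_] := hP u uQ; case hu : (h u) nru nru' => [|m] nru nru' altu.
    by rewrite (subsetP (top u uQ)) in nru.
  have hom' : {in Q :&: B m.+2 u, forall y, adj r' y /\ ~~ adj r y}.
    move=> y /setIP[yQ yB]; rewrite -(hom m.+1 u y r') // -(hom m.+1 u y r) //.
  apply: (alternatesS (subsetIl _ _) rQ' _ (altu m (leqnn _)) hom').
  rewrite !inE rQ andbT /=; apply: contraNN nru.
  exact: (subsetP (sub m.+1 u uQ)).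
(* Only the last three blocks [B (h u) u], [B (h u).+1 u], [B (h u).+2 u] matter for [u]:
   within one colour, vertices with different [B (h u) u] are adjacent iff [e].  The parity
   of [h] excludes the case where each vertex lies in the other's [B (h u) u]. *)
pose color u : level_colors T k.+1 d.+1 :=
  (odd (h u), eps u, p (h u).+1 u, p (h u).+2 u, F (R (h u) u) (rep (h u).+1 u),
   F (R (h u).+1 u) (rep (h u).+2 u), F' (Q :&: B (h u).+2 u) u).
exists color => -[[[[[[o e] q1] q2] c1] c2] c3].
set C := [set _ in _ | _].
have CP u : u \in C -> u \in Q /\ color u = (o, e, q1, q2, c1, c2, c3).
  by rewrite inE => /andP[uQ /eqP].
apply: (@cograph_uniform_blocks _ _ (fun u => (h u, B (h u) u)) _ e).
  have cross u v : u \in C -> v \in C -> h u <= h v -> (h u, B (h u) u) != (h v, B (h v) v) ->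
      adj u v = e.
    move=> /CP[uQ [ou eu _ _ _ _ _]] /CP[vQ [ov ev _ _ _ _ _]].
    rewrite leq_eqVlt => /orP[/eqP huv|lt_uv] neq_uv.
      rewrite adj_sym (epsP u v) //; apply: contraNN neq_uv => vu.
      by rewrite -huv (eqB _ u v).
    rewrite (epsP v u) //; apply/negP=> uv.
    (* Equal parity puts [h v] at least two above [h u], so [u] and [v] would share the block at
       depth [(h u).+2]; it has a chain of length [d] by the choice of [h v] and none by that of
       [h u]. *)
    have le_uv : h u <= (h v).-2 by lia.
    have [nalt_u _] := hP u uQ; have [_ /(_ (h u) lt_uv) alt_v] := hP v vQ.
    case/negP: nalt_u; suff -> : B (h u).+2 u = B (h u).+2 v by [].
    apply: eqB => //; have {lt_uv}lt2 : (h u).+2 <= h v by lia.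
    move: uv; move: (h v) lt2; elim=> // n IHn; rewrite leq_eqVlt => /orP[/eqP->//|lt2].
    by move/(subsetP (sub n v vQ)); apply: IHn.
  move=> u v uC vC neq_uv; case/orP: (leq_total (h u) (h v)) => le_uv; first exact: cross.
  by rewrite adj_sym cross // eq_sym.
case=> n W; set C0 := [set _ in _ | _].
have C0P u : u \in C0 -> [/\ u \in Q, h u = n, B n u = W & color u = (o, e, q1, q2, c1, c2, c3)].
  by rewrite inE => /andP[/CP[uQ cu] /eqP[<- <-]].
have sC0 : C0 \subset Q by apply/subsetP=> u /C0P[].
(* Two substitutions descend from depth [n] to [n.+2], where the induction hypothesis colours the
   block. *)
apply: (refine n c1) => //.
- move=> u v /C0P[uQ hu uW [_ _ pu _ _ _ _]] /C0P[vQ hv vW [_ _ pv _ _ _ _]].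
  by rewrite uW -vW self //; split=> //; rewrite hu in pu; rewrite hv in pv; rewrite pu pv.
- by move=> u /C0P[uQ hu uW [_ _ _ _ cu _ _]]; rewrite hu in cu.
move=> z; set C1 := [set _ in _ | _].
have C1P u : u \in C1 -> u \in C0 /\ rep n.+1 u = z by rewrite inE => /andP[? /eqP].
apply: (refine n.+1 c2).
- by apply: subset_trans sC0; apply/subsetP=> u /C1P[].
- move=> u v /C1P[/C0P[uQ hu uW [_ _ _ pu _ _ _]] zu] /C1P[/C0P[vQ hv vW [_ _ _ pv _ _ _]] zv].
  split; last by rewrite hu in pu; rewrite hv in pv; rewrite pu pv.
  by rewrite -rep_block // zu -zv rep_block ?self.
- by move=> u /C1P[/C0P[uQ hu uW [_ _ _ _ _ cu _]] _]; rewrite hu in cu.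
move=> y; set C2 := [set _ in _ | _].
have C2P u : u \in C2 -> u \in C0 /\ rep n.+2 u = y.
  by rewrite inE => /andP[/C1P[? _] /eqP].
have [->|[u uC]] := set_0Vmem C2; first by apply: cograph_small; rewrite cards0.
have [/C0P[uQ hu uW [_ _ _ _ _ _ cu]] yu] := C2P u uC.
have colu : cograph_colorable (level_colors T k.+1 d) (Q :&: B n.+2 u).
  apply: IHd; first exact: leveled_sub (subsetIl _ _).
  by have [] := hP u uQ; rewrite hu.
apply: cograph_sub (F'P _ colu c3) _; apply/subsetP=> v /C2P[/C0P[vQ hv vW [_ _ _ _ _ _ cv]] yv].
have eqBv : B n.+2 v = B n.+2 u by rewrite -rep_block // yv -yu rep_block.
by rewrite !inE vQ -eqBv self //= -cv hv eqxx.
Qed.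

End Levels.

(** * Laminar families with few types *)

(** One layer per step of the downward induction on [j]: a type over [X], then a level colour. *)
Fixpoint tree_colors k d n : finType :=
  if n is n'.+1 then ('I_k.+1 * level_colors (tree_colors k d n') k.+1 d)%type else unit.

Fixpoint tree_color0 k d n : tree_colors k d n :=
  if n is n'.+1 then (ord0, level_color0 (tree_color0 k d n') k d) else tt.

Section LaminarTree.
Variables (G : sgraph) (k : nat).
Implicit Types (u v r : G) (W X Y Q : {set G}).

Definition outer_nbrs X u := [set r | (r \notin X) && adj u r].

(** [laminar_split] encodes a binary tree: of three vertices in a member, two lie in a common proper
    submember. *)
Record laminar_tree (F : {set {set G}}) : Prop := LaminarTree {
  laminar_set1 : forall u, [set u] \in F;
  laminar_nested : {in F &, forall X Y, [|| X \subset Y, Y \subset X | [disjoint X & Y]]};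
  laminar_split : {in F, forall X (S : {set G}), S \subset X -> 2 < #|S| ->
    exists2 Y : {set G}, Y \in F & (Y \proper X) && (1 < #|S :&: Y|)};
  laminar_rank : {in F, forall X, #|outer_nbrs X @: X| <= k.+1} }.

Variables (F : {set {set G}}) (lamF : laminar_tree F).

Definition rank_in W X := #|outer_nbrs X @: W|.

Lemma rank_in_sub W Y X : W \subset Y -> rank_in W X <= rank_in Y X.
Proof. by move=> sWY; apply/subset_leq_card/imsetS. Qed.

Definition scattered_colorable (T : finType) j := forall X Q, X \in F -> Q \subset X ->
  (forall W, W \in F -> W \subset X -> rank_in W X < j -> #|Q :&: W| <= 1) ->
  cograph_colorable T Q.

Lemma outer_nbrs_sub W X u : W \subset X -> outer_nbrs X u = outer_nbrs W u :\: X.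
Proof.
move=> sWX; apply/setP=> r; rewrite !inE; case rX: (r \in X) => //=.
by rewrite (contraFN _ rX) // => /(subsetP sWX).
Qed.

(* Both ranks equal [j], so merging the types at [Y] into types at [X] is injective on
   those met by [W]. *)
Lemma scattered_homogeneous j W Y X Q u v :
  W \in F -> W \subset Y -> Y \subset X -> rank_in W Y <= j ->
  (forall W, W \in F -> W \subset X -> rank_in W X < j -> #|Q :&: W| <= 1) ->
  {in Q &, forall u v, outer_nbrs X u = outer_nbrs X v} ->
  u \in Q :&: W -> v \in Q :&: W -> outer_nbrs Y u = outer_nbrs Y v.
Proof.
move=> WF sWY sYX rkWY scatQ homQ uQW vQW.
have [lt_j|ge_j] := ltnP (rank_in W X) j.
  have le1 := scatQ W WF (subset_trans sWY sYX) lt_j.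
  by rewrite (card_le1_eqP le1 _ _ uQW vQW).
have imE : outer_nbrs X @: W = (fun A => A :\: X) @: (outer_nbrs Y @: W).
  by rewrite -imset_comp; apply: eq_imset => x /=; apply: outer_nbrs_sub.
have : #|(fun A => A :\: X) @: (outer_nbrs Y @: W)| == #|outer_nbrs Y @: W|.
  by rewrite eqn_leq leq_imset_card -imE (leq_trans rkWY).
move/imset_injP=> inj; move: uQW vQW => /setIP[uQ uW] /setIP[vQ vW].
apply: inj; rewrite ?imset_f //.
by rewrite -!(outer_nbrs_sub _ sYX) (homQ u v).
Qed.

(** The blocks form a [leveled] tree whose transversals are coloured by the hypothesis for [j.+1];
    [0 < j] makes singletons eligible as blocks. *)
Lemma scattered_colorable_step (T : finType) (t0 : T) j d :
  0 < j -> ~~ alternates d [set: G] -> scattered_colorable T j.+1 ->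
  scattered_colorable ('I_k.+1 * level_colors T k.+1 d)%type j.
Proof.
move=> j_gt0 nalt IHj X Q XF sQX scatQ.
(* A type is numbered by its position among the at most [k.+1] types of [Y], so [inord] is exact on
   vertices of a member [Y]. *)
pose type Y u : 'I_k.+1 := inord (index (outer_nbrs Y u) (enum (outer_nbrs Y @: Y))).
have type_inj Y : Y \in F -> {in Y &, forall u v, type Y u = type Y v -> outer_nbrs Y u = outer_nbrs Y v}.
  move=> YF u v uY vY /(congr1 val).
  have mem w : w \in Y -> outer_nbrs Y w \in enum (outer_nbrs Y @: Y).
    by move=> wY; rewrite mem_enum imset_f.
  have lt w : w \in Y -> index (outer_nbrs Y w) (enum (outer_nbrs Y @: Y)) < k.+1.
    move=> wY; apply: leq_trans (laminar_rank lamF YF); rewrite cardE index_mem; exact: mem.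
  rewrite /= !inordK ?lt // => eq_index.
  by rewrite -(nth_index set0 (mem u uY)) eq_index nth_index ?mem.
apply: (cograph_colorable_split (g := type X)) => c.
set Q' := [set _ in _ | _].
have sQ' : Q' \subset Q by apply/subsetP=> u; rewrite inE => /andP[].
have {}scatQ W : W \in F -> W \subset X -> rank_in W X < j -> #|Q' :&: W| <= 1.
  move=> WF sWX /(scatQ W WF sWX); apply: leq_trans.
  exact/subset_leq_card/setSI.
have homQ : {in Q' &, forall u v, outer_nbrs X u = outer_nbrs X v}.
  move=> u v; rewrite !inE => /andP[/(subsetP sQX) uX /eqP<-] /andP[/(subsetP sQX) vX /eqP tv].
  exact: type_inj.
have {sQ'} sQ'X := subset_trans sQ' sQX.
move: Q' sQ'X scatQ homQ => {c sQX} {}Q sQX scatQ homQ.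
(* The singleton is allowed even when it equals [Y], so the descent is defined at every depth and
   stops at [[set u]]. *)
pose child Y u W := [&& W \in F, u \in W, rank_in W Y <= j & (W \proper Y) || (W == [set u])].
pose sub Y u := [arg max_(W > [set u] | child Y u W) #|W|].
have child1 Y u : child Y u [set u].
  rewrite /child (laminar_set1 lamF) set11 eqxx orbT /= andbT.
  by rewrite /rank_in imset_set1 cards1.
have subP Y u : child Y u (sub Y u).
  by rewrite /sub; case: arg_maxnP.
have sub_max Y u W : child Y u W -> W \subset sub Y u.
  move=> cW; rewrite /sub; case: arg_maxnP => // Z cZ /(_ W cW) /= leWZ.
  have [/and4P[WF uW _ _] /and4P[ZF uZ _ _]] := (cW, cZ).
  case/or3P: (laminar_nested lamF WF ZF) => // [sZW|disWZ].
    have /eqP<- : Z == W by rewrite eqEcard sZW.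
    exact: subxx.
  by rewrite (disjointFr disWZ uW) in uZ.
pose B i u := iter i (sub^~ u) X.
have B_F i u : B i u \in F by case: i => [|i] //=; case/and4P: (subP (B i u) u).
have B_self i u : u \in X -> u \in B i u.
  by move=> uX; case: i => [|i] //=; case/and4P: (subP (B i u) u).
have B_sub i u : u \in X -> B i.+1 u \subset B i u.
  move=> uX; case/and4P: (subP (B i u) u) => _ _ _ /orP[/proper_sub //|/eqP /= ->].
  by rewrite sub1set B_self.
have B_subX i u : u \in X -> B i u \subset X.
  by move=> uX; elim: i => //= i IHi; apply: subset_trans (B_sub i u uX) IHi.
have B_rank i u : rank_in (B i.+1 u) (B i u) <= j by case/and4P: (subP (B i u) u).
(* The maximal child of either vertex is eligible for the other, so maximality gives both
   inclusions. *)
have B_eq i : {in X &, forall u v, v \in B i u -> B i v = B i u}.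
  elim: i => // i IHi u v uX vX vB.
  have eqB : B i v = B i u by apply: IHi => //; apply: (subsetP (B_sub i u uX)).
  have /and4P[uF uB rku pu] := subP (B i u) u; have /and4P[vF vB' rkv pv] := subP (B i v) v.
  rewrite /= eqB in vF vB' rkv pv vB *.
  have {}pu : (sub (B i u) u \proper B i u) || (sub (B i u) u == [set v]).
    case/orP: pu => [->//|/eqP eq1]; move: vB; rewrite eq1 => /set1P ->.
    by rewrite eqxx orbT.
  have sub_uv : sub (B i u) u \subset sub (B i u) v by apply: sub_max; apply/and4P.
  apply/eqP; rewrite eqEsubset sub_uv andbT; apply: sub_max; apply/and4P; split=> //.
    exact: (subsetP sub_uv).
  case/orP: pv => [->//|/eqP eq1]; have := subsetP sub_uv u uB.
  by rewrite eq1 => /set1P->; rewrite eqxx orbT.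
have B_bot u : u \in X -> exists i, B i.+2 u = [set u].
  move=> uX.
  (* Sizes drop strictly until a singleton is reached, which happens before depth [#|X|.+2]. *)
  have step i : B i u = [set u] \/ #|B i u| + i <= #|X|.
    elim: i => [|i [eq1|le_i]]; first by right; rewrite addn0.
      left; rewrite /= eq1; case/and4P: (subP [set u] u) => _ us _ /orP[|/eqP//].
      move/proper_card; rewrite cards1 ltnS leqn0 cards_eq0 => /eqP s0.
        by rewrite s0 inE in us.
    case/and4P: (subP (B i u) u) => _ _ _ /orP[/proper_card lt|/eqP]; last by left.
    right; rewrite addnS; apply: leq_trans le_i; by rewrite ltn_add2r.
  exists #|X|; case: (step #|X|.+2) => //; lia.
have lev : leveled T B (fun i u => type (B i u) u) Q.
  have sX := subsetP sQX.
  have outer_adj Y u v r : outer_nbrs Y u = outer_nbrs Y v -> r \notin Y -> adj r u = adj r v.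
    by move=> /setP/(_ r); rewrite !inE => + nrY; rewrite nrY /= ![adj r _]adj_sym.
  split.
  - by move=> i u /sX; apply: B_self.
  - by move=> i u v /sX uX /sX vX; apply: B_eq.
  - by move=> i u /sX; apply: B_sub.
  - by move=> u _.
  - by move=> u /sX; apply: B_bot.
  - move=> i u v r uQ vQ rQ vB; apply: outer_adj.
    have [uX vX] := (sX u uQ, sX v vQ).
    apply: (scattered_homogeneous (B_F i.+1 u) (B_sub i u uX) (B_subX i u uX) (B_rank i u) scatQ homQ).
      by rewrite inE uQ B_self.
    by rewrite inE vQ.
  - move=> i u v r /sX uX /sX vX rQ vB; rewrite (B_eq _ u) // => eqt; apply: outer_adj.
    by apply: (type_inj _ (B_F i u)) => //; apply: B_self.
  move=> i S sSQ tS.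
  have [->|[u uS]] := set_0Vmem S.
    by apply: (cograph_colorable1 t0); apply: cograph_small; rewrite cards0.
  have sSX := subset_trans sSQ sQX; have uX := subsetP sSX u uS.
  have eqB v : v \in S -> B i v = B i u.
    by move=> vS; apply: B_eq => //; [apply: (subsetP sSX)|case: (tS u v uS vS)].
  have sSB : S \subset B i u by apply/subsetP=> v vS; rewrite -(eqB v vS) B_self ?(subsetP sSX).
  (* Such a member lies inside a single child, which [S] meets at most once. *)
  have scatS W : W \in F -> W \proper B i u -> rank_in W (B i u) <= j -> #|S :&: W| <= 1.
    move=> WF pW rkW; apply/card_le1_eqP=> v w /setIP[vS vW] /setIP[wS wW].
    have cW : child (B i v) v W by rewrite /child WF vW eqB // rkW pW.
    have [_] := tS v w vS wS; apply; exact: (subsetP (sub_max _ _ W cW)).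
  (* If the block has more than [j] types over itself, only proper members have to be tested and [S]
     is [j.+1]-scattered. *)
  have [rk_big|rk_small] := ltnP j (rank_in (B i u) (B i u)).
    apply: (IHj _ S (B_F i u) sSB) => W WF; rewrite ltnS => sWB rkW; apply: scatS => //.
    by rewrite properEneq sWB andbT; apply: contraTneq rkW => ->; rewrite -ltnNge.
  (* Here all proper members have at most [j] types over the block, so three vertices of [S] would
     contradict [laminar_split]. *)
  apply: (cograph_colorable1 t0); apply: cograph_card2; rewrite leqNgt; apply/negP=> gt2.
  have [Y YF /andP[pY]] := laminar_split lamF (B_F i u) sSB gt2.
  rewrite ltnNge scatS //; apply: leq_trans rk_small; exact/rank_in_sub/proper_sub.
apply: leveled_colorable lev _ => //; apply: contraNN nalt => /alternates_sub; apply; exact: subsetT.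
Qed.

(** The induction runs from [j = k.+2], where scattered sets have at most one vertex because ranks
    are at most [k.+1], down to [j = 1], where every set is scattered because rank 0 means empty. *)
Lemma laminar_tree_colorable d X : X \in F -> ~~ alternates d [set: G] ->
  cograph_colorable (tree_colors k d k.+1) X.
Proof.
move=> XF nalt.
have col n : n <= k.+1 -> scattered_colorable (tree_colors k d n) (k.+2 - n).
  elim: n => [_|n IHn lt_n].
    move=> Y Q YF sQY scatQ; apply: (cograph_colorable1 (tt : tree_colors k d 0)).
    apply: cograph_small; rewrite -(setIidPl sQY); apply: scatQ => //.
    by rewrite subn0 ltnS; apply: laminar_rank lamF _ YF.
  apply: scattered_colorable_step => //; first exact: tree_color0.
    by rewrite subn_gt0.
  by rewrite subnSK; [apply: IHn; apply: ltnW|apply: leq_trans lt_n _].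
apply: (col k.+1 (leqnn _) X X XF (subxx X)) => W WF sWX.
rewrite subSnn ltnS leqn0 cards_eq0 imset_eq0 => /eqP->; by rewrite setI0 cards0.
Qed.

End LaminarTree.

(** * Rank decompositions *)

(** Types are supports of rows of the cut matrix, and its row space over ['F_2] has [2 ^ cut_rank X]
    elements. *)
Lemma card_outer_nbrs (G : sgraph) (X : {set G}) :
  #|outer_nbrs X @: X| <= 2 ^ cut_rank X.
Proof.
rewrite /cut_rank; set M := (\matrix_(_, _) _)%R.
pose decode (c : 'rV['F_2]_(\rank M)) :=
  [set enum_val j | j : 'I_#|~: X| & ((c *m row_base M)%R ord0 j != 0)%R].
have sub : outer_nbrs X @: X \subset decode @: [set: 'rV['F_2]_(\rank M)].
  apply/subsetP=> _ /imsetP[u uX ->]; pose i := enum_rank_in uX u.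
  have iE : enum_val i = u by apply: enum_rankK_in.
  have /submxP[c cE] : (row i M <= row_base M)%MS by rewrite eq_row_base row_sub.
  apply/imsetP; exists c => //; rewrite /decode -cE.
  apply/setP=> r; rewrite inE; apply/andP/imsetP => [[rX ur]|[j]].
    have rC : r \in ~: X by rewrite inE.
    exists (enum_rank_in rC r); last by rewrite enum_rankK_in.
    by rewrite inE !mxE iE enum_rankK_in // ur.
  rewrite inE !mxE iE => nz ->; split; last by case: (adj u _) nz.
  by have := enum_valP j; rewrite inE.
apply: leq_trans (subset_leq_card sub) _; apply: leq_trans (leq_imset_card _ _) _.
by rewrite cardsT card_mx card_Fp // mul1n.
Qed.

(** * Components of a tree minus an edge *)

Section Branches.
Variables (T : sgraph) (treeT : is_tree T).
Implicit Types u v w x y a b : T.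

Definition branch_rel u v : rel T := [rel a b | adj a b && ([set a; b] != [set u; v])].
Definition branch u v : {set T} := [set y | connect (branch_rel u v) u y].

Lemma branch_root u v : u \in branch u v.
Proof. by rewrite inE connect0. Qed.

Lemma branch_rel_sym u v : connect_sym (branch_rel u v).
Proof. by apply: sym_connect_sym => a b; rewrite /branch_rel /= adj_sym setUC. Qed.

Lemma branch_exit u v a b : a \in branch u v -> b \notin branch u v -> adj a b -> a = u /\ b = v.
Proof.
rewrite !inE => ua nub ab; have nbu : b != u by apply: contraNneq nub => ->; apply: connect0.
have : [set a; b] == [set u; v].
  apply: contraNT nub => nab; apply: connect_trans ua _; apply: connect1.
  by rewrite /branch_rel /= ab.
move=> /eqP/setP eqs; move: (eqs a) (eqs b); rewrite !inE !eqxx orbT (negPf nbu) /=.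
move=> + /esym/eqP eqb; rewrite eqb -eqb => /esym/orP[/eqP//|/eqP eqa].
by rewrite eqa eqb adj_irrefl in ab.
Qed.

Lemma connect_exit (e : rel T) (Z : {set T}) x y :
  connect e x y -> x \in Z -> y \notin Z ->
  exists a b, [/\ connect e x a, a \in Z, b \notin Z & e a b].
Proof.
case/connectP=> p; elim: p x => [|z p IHp] x /=; first by move=> _ -> ->.
case/andP=> xz zp lasty xZ yZ; have [zZ|zZ] := boolP (z \in Z).
  have [a [b [za aZ bZ ab]]] := IHp z zp lasty zZ yZ; exists a, b; split=> //.
  exact: connect_trans (connect1 xz) za.
by exists x, z; split=> //; apply: connect0.
Qed.

Lemma branch_cross u v (Z : {set T}) x y :
  x \in branch u v -> y \in branch u v -> x \in Z -> y \notin Z ->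
  exists a b, [/\ b \in branch u v, a \in Z, b \notin Z & adj a b].
Proof.
rewrite !inE => ux uy xZ yZ.
have xy : connect (branch_rel u v) x y.
  by apply: connect_trans uy; rewrite branch_rel_sym.
have [a [b [xa aZ bZ ab]]] := connect_exit xy xZ yZ; exists a, b; split=> //.
  by rewrite inE; apply: connect_trans (connect_trans ux xa) (connect1 ab).
by case/andP: ab.
Qed.

(** If the branches cross, connectivity inside each forces [v'] into the first and [v] into the
    second; but a path to [r] must leave the union through one of these two vertices. *)
Lemma branch_nested u v u' v' r : r \notin branch u v -> r \notin branch u' v' ->
  [|| branch u v \subset branch u' v', branch u' v' \subset branch u v
    | [disjoint branch u v & branch u' v']].
Proof.
case: treeT => _ conn _ rX rX'.
apply/or3P; have [sXX'|/subsetPn[y yX yX']] := boolP (branch u v \subset branch u' v').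
  by constructor 1.
have [sX'X|/subsetPn[y' y'X' y'X]] := boolP (branch u' v' \subset branch u v).
  by constructor 2.
constructor 3; apply/pred0P=> x /=; apply/negP=> /andP[xX xX'].
have [a [b [bX aX' bX' ab]]] := branch_cross xX yX xX' yX'.
have [_ eb] := branch_exit aX' bX' ab.
have [c [d [dX' cX dX cd]]] := branch_cross xX' y'X' xX y'X.
have [_ ed] := branch_exit cX dX cd.
have [||p [q [_ pXX' + pq]]] := connect_exit (Z := branch u v :|: branch u' v') (conn x r).
- by rewrite in_setU xX.
- by rewrite in_setU negb_or rX.
rewrite in_setU negb_or => /andP[qX qX']; rewrite in_setU in pXX'.
case/orP: pXX' => [pX|pX'].
  by have [_ eq] := branch_exit pX qX pq; rewrite eq -ed dX' in qX'.
by have [_ eq] := branch_exit pX' qX' pq; rewrite eq -eb bX in qX.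
Qed.

(** A simple path from [u] to [v] avoiding the edge would close to a cycle. *)
Lemma branch_acyclic u v : adj u v -> v \notin branch u v.
Proof.
case: treeT => _ _ acyc uv; rewrite inE; apply/negP=> /connectP[p0 p0P lastv].
case/shortenP: p0P lastv => p pP uniqp _ lastv.
apply: (acyc (u :: p)).
  case: p pP lastv {uniqp} => [_ /= eq_vu|w [|//]]; first by rewrite eq_vu adj_irrefl in uv.
  by rewrite /= andbT => /andP[_ +] eq_vw; rewrite eq_vw eqxx.
rewrite /ucycle uniqp andbT /= rcons_path -lastv adj_sym uv andbT.
by apply: sub_path pP => a b /andP[].
Qed.

(** After its first step a simple path never returns to [u], so it avoids the edge between [w] and
    [u]. *)
Lemma branch_step (e : rel T) u y : subrel e (@adj T) -> connect e u y -> y != u ->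
  exists2 w, e u w & y \in branch w u.
Proof.
move=> sub_e /connectP[p0 p0P lasty]; case/shortenP: p0P lasty => -[|w p] /=.
  by move=> _ _ _ ->; rewrite eqxx.
case/andP=> uw pP /andP[uwp _] _ lasty _; exists w; rewrite // inE.
apply/connectP; exists p => //.
apply: (sub_in_path (P := predC1 u)) pP; last first.
  by apply/allP=> z zwp; rewrite inE; apply: contraNneq uwp => <-.
move=> a b; rewrite !inE => au bu ab; rewrite /branch_rel /= sub_e //=; apply/eqP=> /setP/(_ u).
by rewrite !inE eqxx orbT ![u == _]eq_sym (negPf au) (negPf bu).
Qed.

(** A path from [w] leaving [branch u v] would pass through [u], which is not in [branch w u]. *)
Lemma branch_child u v w : adj u v -> adj u w -> w != v -> branch w u \proper branch u v.
Proof.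
move=> uv uw nwv; have nu : u \notin branch w u by apply: branch_acyclic; rewrite adj_sym.
apply/properP; split; last by exists u; rewrite // branch_root.
apply/subsetP=> y; rewrite inE => wy; apply/negPn/negP=> ny.
have wuv : w \in branch u v.
  rewrite inE; apply: connect1; rewrite /branch_rel /= uw; apply/eqP=> /setP/(_ w).
  rewrite !inE eqxx orbT (negPf nwv) orbF => /esym/eqP eqwu.
  by rewrite eqwu adj_irrefl in uw.
have [a [b [wa aZ bZ /andP[ab _]]]] := connect_exit wy wuv ny.
by have [eqa _] := branch_exit aZ bZ ab; rewrite eqa in wa; rewrite inE wa in nu.
Qed.

End Branches.

(** * From a rank decomposition to a laminar family *)

Section RankDecomposition.
Variables (G T : sgraph) (L : G -> T) (k : nat).
Hypotheses (decL : rank_decomposition L)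
  (rankL : forall u v : T, adj u v -> 2 ^ cut_rank (edge_side L u v) <= k.+1).

Lemma edge_sideE u v x : (x \in edge_side L u v) = (L x \in branch u v).
Proof. by rewrite !inE. Qed.

(** Keeping for each edge only the side away from [root] makes the family laminar. *)
Definition side_family (root : T) : {set {set G}} :=
  [set: G] |: ([set [set x] | x : G] :|:
    [set edge_side L e.1 e.2 | e : T * T & adj e.1 e.2 && (root \notin branch e.1 e.2)]).

Lemma side_family_cases root (P : {set G} -> Prop) :
  P [set: G] -> (forall x, P [set x]) ->
  (forall u v, adj u v -> root \notin branch u v -> P (edge_side L u v)) ->
  forall X, X \in side_family root -> P X.
Proof.
move=> PT P1 Pe X; rewrite !inE => /orP[/eqP->//|/orP[/imsetP[x _ ->]//|]].
by case/imsetP=> -[u v]; rewrite inE => /andP[uv nr] ->; apply: Pe.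
Qed.

Lemma side_family_edge root u v : adj u v -> root \notin branch u v ->
  edge_side L u v \in side_family root.
Proof.
move=> uv nr; rewrite !inE (imset_f _ (x := (u, v))) ?orbT //.
by rewrite inE uv.
Qed.

Lemma side_family_laminar x0 : laminar_tree k (side_family (L x0)).
Proof.
case: decL => treeT deg3 L_inj leavesL.
have [_ conn _] := treeT.
have nbr_leaf x : exists n, [set y | adj (L x) y] = [set n].
  have : L x \in [set L x | x : G] by apply: imset_f.
  by rewrite leavesL inE => /cards1P.
split.
- by move=> x; rewrite !inE imset_f ?orbT.
- move=> X Y XF YF; move: X XF; apply: side_family_cases.
  + by rewrite !subsetT orbT.
  + move=> x; rewrite sub1set; case xY: (x \in Y) => //=.
    by rewrite disjoints1 xY orbT.
  move=> u v uv nuv; move: Y YF; apply: side_family_cases.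
  + by rewrite subsetT.
  + move=> x; rewrite !sub1set orbCA; case xX: (x \in edge_side L u v) => //=.
    by rewrite disjoint_sym disjoints1 xX orbT.
  move=> u' v' uv' nuv'; case/or3P: (branch_nested treeT nuv nuv') => [sub|sub|dis].
  + by apply/or3P; constructor 1; apply/subsetP=> x; rewrite !edge_sideE; apply: (subsetP sub).
  + by apply/or3P; constructor 2; apply/subsetP=> x; rewrite !edge_sideE; apply: (subsetP sub).
  + apply/or3P; constructor 3; apply/pred0P=> x; rewrite /= !edge_sideE.
    by apply/negP=> /andP[/(disjointFr dis)->].
- move=> X XF S sSX gt2; move: X XF sSX; apply: side_family_cases.
  (* The root is a leaf, so the far side of its only edge misses just [x0]. *)
  + move=> _; have [n nE] := nbr_leaf x0.
    have x0n : adj (L x0) n by have := set11 n; rewrite -nE inE.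
    have nx0 : L x0 \notin branch n (L x0) by apply: branch_acyclic; rewrite // adj_sym.
    exists (edge_side L n (L x0)); first by apply: side_family_edge; rewrite // adj_sym.
    apply/andP; split.
      apply/properP; split; first exact: subsetT.
      by exists x0; rewrite // edge_sideE.
    have sub : S :\ x0 \subset S :&: edge_side L n (L x0).
      apply/subsetP=> x /setD1P[nx xS]; rewrite inE xS edge_sideE.
      have [||w x0w Lx] := branch_step _ (conn (L x0) (L x)) => //.
        by rewrite (inj_eq L_inj).
      by have : w \in [set n]; [rewrite -nE inE|move/set1P=> <-].
    apply: leq_trans (subset_leq_card sub); move: gt2; rewrite (cardsD1 x0).
    by case: (x0 \in S); rewrite ?add0n // => /ltnW.
  + move=> x /subset_leq_card; rewrite cards1 => le1; lia.
  move=> u0 v0 uv0 nuv0 sSX.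
  (* Different edges may have the same side; the smallest such branch is taken so that the side
     found below it is a proper subset. *)
  pose ok (e : T * T) := [&& adj e.1 e.2, L x0 \notin branch e.1 e.2
    & edge_side L e.1 e.2 == edge_side L u0 v0].
  have ok0 : ok (u0, v0) by rewrite /ok /= uv0 nuv0 eqxx.
  have [[u v] /and3P[/= uv nuv /eqP eqX] min_uv] := arg_minnP (fun e : T * T => #|branch e.1 e.2|) ok0.
  rewrite -eqX in sSX *.
  have LS x : x \in S -> L x \in branch u v.
    by move/(subsetP sSX); rewrite edge_sideE.
  have sub_rel : subrel (branch_rel u v) (@adj T) by move=> a b /andP[].
  have next x : x \in S -> L x != u -> exists2 w, adj u w && (w != v) & L x \in branch w u.
    move=> xS nx; have := LS x xS; rewrite inE => /(branch_step sub_rel)/(_ nx)[w /andP[uw nuw] Lw].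
    exists w => //; rewrite uw; apply: contraNneq nuw => ->; exact: eqxx.
  (* Otherwise [u] is a leaf with [v] as its only neighbour, and no other vertex of [S] could be
     reached. *)
  have nu x : x \in S -> L x != u.
    move=> xS; apply/negP=> /eqP Lx; have [n nE] := nbr_leaf x.
    have [y] : exists y, y \in S :\ x.
      by apply/card_gt0P; rewrite (cardsD1 x) xS in gt2; lia.
    case/setD1P=> nyx yS; have [|w /andP[uw nwv] _] := next y yS.
      by rewrite -Lx (inj_eq L_inj).
    have : (w \in [set n]) && (v \in [set n]) by rewrite -nE !inE Lx uw uv.
    by case/andP=> /set1P ew /set1P ev; rewrite ew ev eqxx in nwv.
  pose f x := odflt u [pick w | [&& adj u w, w != v & L x \in branch w u]].
  have fP x : x \in S -> [/\ adj u (f x), f x != v & L x \in branch (f x) u].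
    move=> xS; rewrite /f; case: pickP => [w /and3P[]//|none].
    by have [w /andP[uw nwv] Lw] := next x xS (nu x xS); have := none w; rewrite uw nwv Lw.
  (* Pigeonhole: [u] has at most two neighbours besides [v], and [S] has at least three vertices. *)
  have : ~~ dinjectiveb f S.
    apply/negP=> /dinjectiveP f_inj; have : f @: S \subset [set y | adj u y] :\ v.
      by apply/subsetP=> _ /imsetP[x xS ->]; have [ux nx _] := fP x xS; rewrite !inE nx.
    move/subset_leq_card; rewrite (card_in_imset f_inj); have := deg3 u.
    rewrite /degree (cardsD1 v) inE uv; lia.
  case/dinjectivePn=> x xS [y /andP[/= nyx yS] eqf].
  have [uw nwv Lx] := fP x xS; have [_ _ Ly] := fP y yS; rewrite -eqf in Ly.
  have prop := branch_child treeT uv uw nwv.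
  have nw : L x0 \notin branch (f x) u by apply: contraNN nuv; apply: (subsetP (proper_sub prop)).
  exists (edge_side L (f x) u); first by apply: side_family_edge; rewrite // adj_sym.
  apply/andP; split.
    rewrite properEneq; apply/andP; split.
      apply: contraTneq (proper_card prop) => eqs; rewrite -leqNgt.
      by apply: (min_uv (f x, u)); rewrite /ok /= adj_sym uw nw eqs eqX eqxx.
    apply/subsetP=> z; rewrite !edge_sideE; exact: (subsetP (proper_sub prop)).
  apply/card_gt1P; exists x, y; rewrite !in_setI !edge_sideE xS yS Lx Ly eq_sym; by split.
- move=> X XF; move: X XF; apply: side_family_cases.
  + apply: leq_trans (_ : #|[set (set0 : {set G})]| <= _); last by rewrite cards1.
    apply/subset_leq_card/subsetP=> _ /imsetP[x _ ->]; rewrite inE; apply/eqP/setP=> r.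
    by rewrite !inE.
  + by move=> x; rewrite imset_set1 cards1.
  + move=> u v uv _; exact: leq_trans (card_outer_nbrs _) (rankL uv).
Qed.

End RankDecomposition.

Lemma rankwidth_cograph_colorable r t (G : sgraph) :
  rankwidth_le G r -> half_graph_free G t ->
  cograph_colorable (tree_colors (2 ^ r).-1 t.*2 (2 ^ r).-1.+1) [set: G].
Proof.
move=> + freeG; case=> [le1|[T [L [decL rankL]]]].
  by apply: (cograph_colorable1 (tree_color0 _ _ _)); apply: cograph_small; rewrite cardsT.
have [T0|[x0 _]] := set_0Vmem [set: G].
  by apply: (cograph_colorable1 (tree_color0 _ _ _)); apply: cograph_small; rewrite T0 cards0.
have rank2 u v : adj u v -> 2 ^ cut_rank (edge_side L u v) <= (2 ^ r).-1.+1.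
  by move=> /rankL le_r; rewrite prednK ?expn_gt0 // leq_exp2l.
apply: (laminar_tree_colorable (side_family_laminar decL rank2 x0)).
  by rewrite !inE eqxx.
exact: half_graph_free_alternates.
Qed.

(** * Linear chi-boundedness *)

Lemma cograph_induced (G : sgraph) (A : {set G}) (X : {set induced A}) :
  cograph X -> cograph (val @: X).
Proof.
elim=> {X} [X le1|X Y Z e -> _ cY _ cZ YZ].
  by apply: cograph_small; apply: leq_trans (leq_imset_card _ _) le1.
apply: (cograph_glue _ cY cZ); first exact: imsetU.
by move=> _ _ /imsetP[y yY ->] /imsetP[z zZ ->]; apply: YZ yY zZ.
Qed.

Lemma chromatic_number_le (G : sgraph) (D : finType) (f : G -> D) :
  (forall x y, adj x y -> f x != f y) -> chromatic_number G <= #|D|.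
Proof.
move=> fP; rewrite /chromatic_number; case: ex_minnP => m _; apply.
apply/existsP; exists [ffun x => enum_rank (f x)].
apply/forallP=> x; apply/forallP=> y; apply/implyP=> /fP; rewrite !ffunE.
by apply: contra_neq => /enum_rank_inj.
Qed.

Lemma clique_number_induced (G : sgraph) (A K : {set G}) :
  clique K -> K \subset A -> #|K| <= clique_number (induced A).
Proof.
move=> /forall_inP cK sKA; pose K' : {set induced A} := [set x | val x \in K].
have <- : #|K'| = #|K|.
  rewrite -(card_imset _ val_inj); congr #|pred_of_set _|; apply/setP=> x.
  apply/imsetP/idP => [[y + ->]|xK]; first by rewrite inE.
  by exists (exist _ x (subsetP sKA x xK)); rewrite ?inE.
apply: (leq_bigmax_cond (P := @clique (induced A)) (F := fun X => #|X|)).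
apply/forall_inP=> x xK; apply/forall_inP=> y yK; apply/implyP=> nxy.
rewrite !inE in xK yK; have /forall_inP/(_ _ yK)/implyP := cK _ xK; apply.
by apply: contraNneq nxy => /val_inj->.
Qed.

Theorem theorem1p4 (C : graph_class) :
  low_rankwidth_covers C ->
  stable_edge_relation C ->
  linearly_chi_bounded C.
Proof.
move=> /(_ 1 isT)[N [X [[r rwX] coverC]]] [t stableC].
pose T := tree_colors (2 ^ r).-1 t.*2 (2 ^ r).-1.+1.
(* One part for each pair of a covering set and a cograph colour; each part costs at most omega
   colours. *)
exists (#|{: 'I_N * T}|) => G CG A; have [U [XU coverU _]] := coverC G CG.
have freeG := half_graph_freeP (stableC G CG).
have /fin_all_exists[f fP] i : exists f : induced (U i) -> T,
    forall c, cograph [set x in [set: induced (U i)] | f x == c].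
  exact: rankwidth_cograph_colorable (rwX _ (XU i)) (half_graph_free_induced freeG).
pose part (d : 'I_N * T) : {set G} :=
  A :&: val @: [set x in [set: induced (U d.1)] | f d.1 x == d.2].
have /fin_all_exists[g gP] (d : 'I_N * T) : exists g : G -> nat,
    {in part d, forall x, g x < clique_number (induced A)} /\
    {in part d &, forall x y, adj x y -> g x != g y}.
  have [|K [g [sK cK gK gP]]] := @cograph_coloring _ (part d).
    exact: cograph_sub (cograph_induced (fP d.1 d.2)) (subsetIr _ _).
  exists g; split=> // x /gK lt_g; apply: leq_trans lt_g _.
  exact: clique_number_induced cK (subset_trans sK (subsetIl _ _)).
(* Parts may overlap, so each vertex selects one part containing it, and its final colour pairs that
   part with the colour inside it. *)
have /fin_all_exists[h hP] (x : induced A) :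
    exists d : ('I_N * T) * 'I_(clique_number (induced A)), val x \in part d.1 /\ g d.1 (val x) = d.2.
  have : val x \in \bigcup_i U i by rewrite coverU.
  case/bigcupP=> i _ xU; pose y : induced (U i) := exist _ (val x) xU.
  have xpart : val x \in part (i, f i y).
    rewrite inE (valP x); apply/imsetP; exists y; rewrite // !inE /=; exact: eqxx.
  by exists ((i, f i y), Ordinal ((gP (i, f i y)).1 _ xpart)).
rewrite -[clique_number _]card_ord -card_prod; apply: (chromatic_number_le (f := h)) => x y xy.
have [xpart gx] := hP x; have [ypart gy] := hP y.
apply: contraTneq xy => eqh; rewrite -eqh in ypart gy.
by apply/negP=> /((gP _).2 _ _ xpart ypart); rewrite gx gy eqxx.
Qed.
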